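(* Let $0\le\delta<1$, $\alpha_1\ge 1$, $0<\alpha_2\le 1$, and let $\pi_1,\pi_2>0$ with $\pi_1+\pi_2<1$. Define, for $x\in[0,1]$, $L_i(x)=0$ for $0\le x\le\delta$ ($i=1,2,3$) and, for $\delta\le x\le 1$, $$L_1(x)=\frac{x-\delta}{1-\delta},\qquad L_2(x)=\left(\frac{x-\delta}{1-\delta}\right)^{\alpha_1},\qquad L_3(x)=1-\left(1-\frac{x-\delta}{1-\delta}\right)^{\alpha_2},$$ and $L_4(x)=\pi_1L_1(x)+\pi_2L_2(x)+(1-\pi_1-\pi_2)L_3(x)$ for $x\in[0,1]$. Then each of $L_1,L_2,L_3,L_4$ is a genuine Lorenz curve.
   Context: A genuine Lorenz curve is a function $L:[0,1]\to[0,1]$ satisfying $L(0)=0$, $L(1)=1$, and which is nondecreasing and convex on $[0,1]$. *)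

(* Defs.v *)
From mathcomp Require Import all_boot all_order all_algebra.
From mathcomp Require Import all_classical all_reals all_analysis.

Set Implicit Arguments.
Unset Strict Implicit.
Unset Printing Implicit Defensive.

Import Order.TTheory GRing.Theory Num.Theory.

Local Open Scope classical_set_scope.
Local Open Scope ring_scope.

(* Functions on [0,1] are represented by total functions R -> R; only their
   values on [0,1] matter. *)
Definition genuine_lorenz (R : realType) (L : R -> R) : Prop :=
  [/\ set_fun `[0, 1] `[0, 1] L,
      L 0 = 0,
      L 1 = 1,
      {in `[0, 1] &, nondecreasing_fun L} &
      convex_function (E := R^o) `[0, 1] L].

(* The two clauses of each piecewise definition overlap at x = delta; the
   lemmas lorenz1E, lorenz2E and lorenz3E below show that they agree there. *)
Definition lorenz1 (R : realType) (delta x : R) : R :=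
  if x <= delta then 0 else (x - delta) / (1 - delta).

Definition lorenz2 (R : realType) (delta alpha1 x : R) : R :=
  if x <= delta then 0 else ((x - delta) / (1 - delta)) `^ alpha1.

Definition lorenz3 (R : realType) (delta alpha2 x : R) : R :=
  if x <= delta then 0 else 1 - (1 - (x - delta) / (1 - delta)) `^ alpha2.

Definition lorenz4 (R : realType) (delta alpha1 alpha2 pi1 pi2 x : R) : R :=
  pi1 * lorenz1 delta x + pi2 * lorenz2 delta alpha1 x
  + (1 - pi1 - pi2) * lorenz3 delta alpha2 x.

Lemma lorenz1E (R : realType) (delta x : R) : delta <= x ->
  lorenz1 delta x = (x - delta) / (1 - delta).
Proof.
rewrite /lorenz1 le_eqVlt => /predU1P[<-|dx]; last by rewrite leNgt dx.
by rewrite lexx subrr mul0r.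
Qed.

Lemma lorenz2E (R : realType) (delta alpha1 x : R) :
  1 <= alpha1 -> delta <= x ->
  lorenz2 delta alpha1 x = ((x - delta) / (1 - delta)) `^ alpha1.
Proof.
move=> a1; rewrite /lorenz2 le_eqVlt => /predU1P[<-|dx]; last by rewrite leNgt dx.
by rewrite lexx subrr mul0r powR0// gt_eqF// (lt_le_trans ltr01).
Qed.

Lemma lorenz3E (R : realType) (delta alpha2 x : R) : delta <= x ->
  lorenz3 delta alpha2 x = 1 - (1 - (x - delta) / (1 - delta)) `^ alpha2.
Proof.
rewrite /lorenz3 le_eqVlt => /predU1P[<-|dx]; last by rewrite leNgt dx.
by rewrite lexx subrr mul0r subr0 powR1 subrr.
Qed.

(* Main.v *)
Require Import Defs.
From mathcomp Require Import all_boot all_order all_algebra.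
From mathcomp Require Import all_classical all_reals all_analysis.
From mathcomp Require Import ring lra.

Import Order.TTheory GRing.Theory Num.Theory.

Local Open Scope ring_scope.

(** Genuine Lorenz curves are closed under composition and under convex
    combination. With u(x) = max(0, (x - delta) / (1 - delta)), which is L_1
    and is a Lorenz curve as the maximum of two nondecreasing affine functions,
    L_2 is the power curve u^alpha1 composed with L_1, and L_3 is the curve
    1 - (1 - u)^alpha2 composed with L_1, while L_4 is a convex combination of
    the three. It remains to see that the two outer curves are convex: the
    first because t |-> t^alpha1 is convex for alpha1 >= 1
    ([convex_powR]), the second because t |-> t^alpha2 is concave for
    0 < alpha2 <= 1 ([concave_powR]), which follows from the convexity of the
    inverse function t |-> t^(1 / alpha2). *)

(** The range condition follows from monotonicity and the two endpoint values,
    and convexity is restated with a real weight, which is the form in which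
    ordered-field arithmetic applies. *)
Lemma genuine_lorenzP (R : realType) (L : R -> R) :
  genuine_lorenz L <->
  [/\ L 0 = 0, L 1 = 1,
      forall x y, 0 <= x -> x <= y -> y <= 1 -> L x <= L y &
      forall p x y, 0 <= p <= 1 -> 0 <= x <= 1 -> 0 <= y <= 1 ->
        L (p * x + (1 - p) * y) <= p * L x + (1 - p) * L y].
Proof.
split=> [[_ L0 L1 Lnd Lcvx]|[L0 L1 Lnd Lcvx]]; split=> //.
- move=> x y x0 xy y1; apply: Lnd => //; rewrite in_itv/= ?x0 ?y1 ?andbT.
    exact: le_trans xy y1.
  exact: le_trans x0 xy.
- move=> p x y /andP[p0 p1] x01 y01.
  have := Lcvx (Itv01 p0 p1) x y; rewrite !convRE/=.
  by apply; rewrite inE/= in_itv.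
- move=> x /=; rewrite !in_itv/= => /andP[x0 x1].
  by apply/andP; split; [rewrite -L0 | rewrite -L1]; apply: Lnd.
- move=> x y; rewrite !in_itv/= => /andP[x0 _] /andP[_ y1] xy.
  exact: Lnd.
- move=> t x y; rewrite !inE/= !in_itv/= => x01 y01.
  rewrite !convRE; apply: Lcvx => //; apply/andP; split; [exact: ge0|exact: le1].
Qed.

Lemma genuine_lorenz_range (R : realType) (L : R -> R) (x : R) :
  genuine_lorenz L -> 0 <= x <= 1 -> 0 <= L x <= 1.
Proof. by case=> + _ _ _ _ x01 => /(_ x) /=; rewrite !in_itv; apply. Qed.

(** Composition preserves convexity because the outer curve is nondecreasing. *)
Lemma genuine_lorenz_comp (R : realType) (g L : R -> R) :
  genuine_lorenz g -> genuine_lorenz L -> genuine_lorenz (g \o L).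
Proof.
move=> gL LL; have Lr x := genuine_lorenz_range _ _ x LL.
case/genuine_lorenzP: gL => g0 g1 gnd gcvx.
case/genuine_lorenzP: LL => L0 L1 Lnd Lcvx.
apply/genuine_lorenzP; split=> /=; rewrite ?L0 ?L1//.
- move=> x y x0 xy y1.
  have /andP[Lx0 _] : 0 <= L x <= 1 by apply: Lr; lra.
  have /andP[_ Ly1] : 0 <= L y <= 1 by apply: Lr; lra.
  by apply: gnd => //; exact: Lnd.
- move=> p x y p01 x01 y01; have Lx := Lr _ x01; have Ly := Lr _ y01.
  apply: le_trans (gcvx _ _ _ p01 Lx Ly); apply: gnd.
  + have /andP[//] : 0 <= L (p * x + (1 - p) * y) <= 1 by apply: Lr; nra.
  + exact: Lcvx.
  + nra.
Qed.

Lemma genuine_lorenz_conv (R : realType) (a b c : R) (f g h : R -> R) :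
  0 <= a -> 0 <= b -> 0 <= c -> a + b + c = 1 ->
  genuine_lorenz f -> genuine_lorenz g -> genuine_lorenz h ->
  genuine_lorenz (fun x => a * f x + b * g x + c * h x).
Proof.
move=> a0 b0 c0 abc.
move=> /genuine_lorenzP[f0 f1 fnd fcvx] /genuine_lorenzP[g0 g1 gnd gcvx].
move=> /genuine_lorenzP[h0 h1 hnd hcvx].
apply/genuine_lorenzP; split.
- by rewrite f0 g0 h0 !mulr0 !addr0.
- by rewrite f1 g1 h1 !mulr1.
- by move=> x y x0 xy y1; rewrite !lerD// ler_wpM2l// ?fnd ?gnd ?hnd.
- move=> p x y p01 x01 y01.
  rewrite [leRHS](_ : _ = a * (p * f x + (1 - p) * f y)
    + b * (p * g x + (1 - p) * g y) + c * (p * h x + (1 - p) * h y));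
    last by ring.
  by rewrite !lerD// ler_wpM2l// ?fcvx ?gcvx ?hcvx.
Qed.

(** Convexity of t |-> t^(1 / a) at the points x^a and y^a bounds
    (p x^a + (1 - p) y^a)^(1 / a) by p x + (1 - p) y; raising both sides to
    the power a gives the claim. *)
Lemma concave_powR (R : realType) (a p x y : R) :
  0 < a -> a <= 1 -> 0 <= p <= 1 -> 0 <= x -> 0 <= y ->
  p * x `^ a + (1 - p) * y `^ a <= (p * x + (1 - p) * y) `^ a.
Proof.
move=> a0 a1 /andP[p0 p1] x0 y0; have aN0 : a != 0 by rewrite gt_eqF.
have ia1 : 1 <= a^-1 by rewrite invf_ge1.
have := convex_powR ia1 (Itv01 p0 p1) (x := x `^ a) (y := y `^ a).
rewrite !inE/= !in_itv/= !powR_ge0 !convRE/= -!powRrM mulfV// !powRr1//.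
move=> /(_ isT isT) cvx.
have q0 : 0 <= 1 - p by rewrite subr_ge0.
have m0 : 0 <= p * x `^ a + (1 - p) * y `^ a.
  by rewrite addr_ge0// mulr_ge0// powR_ge0.
(* The left-hand side is written as its own (1 / a * a)-th power. *)
rewrite -[leLHS]powRr1// -[X in _ `^ X <= _](mulVf aN0) powRrM.
apply: ge0_ler_powR; rewrite ?nnegrE ?powR_ge0 ?addr_ge0 ?mulr_ge0//.
exact: ltW.
Qed.

Lemma genuine_lorenz_powR (R : realType) (a : R) :
  1 <= a -> genuine_lorenz (fun x => x `^ a).
Proof.
move=> a1; have a0 : 0 < a by rewrite (lt_le_trans ltr01).
apply/genuine_lorenzP; split.
- by rewrite powR0// gt_eqF.
- by rewrite powR1.
- move=> x y x0 xy _; have y0 := le_trans x0 xy.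
  by rewrite ge0_ler_powR ?nnegrE// ltW.
- move=> p x y /andP[p0 p1] /andP[x0 _] /andP[y0 _].
  have := convex_powR a1 (Itv01 p0 p1) (x := x) (y := y).
  by rewrite !inE/= !in_itv/= x0 y0 !convRE/=; apply.
Qed.

Lemma genuine_lorenz_powR_dual (R : realType) (a : R) :
  0 < a -> a <= 1 -> genuine_lorenz (fun x => 1 - (1 - x) `^ a).
Proof.
move=> a0 a1; apply/genuine_lorenzP; split.
- by rewrite subr0 powR1 subrr.
- by rewrite subrr powR0 ?subr0// gt_eqF.
- move=> x y x0 xy y1; rewrite lerB// ge0_ler_powR ?nnegrE ?subr_ge0 ?lerB//.
    exact: ltW.
  exact: le_trans xy y1.
- move=> p x y p01 /andP[_ x1] /andP[_ y1].
  have := @concave_powR R a p (1 - x) (1 - y) a0 a1 p01.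
  rewrite !subr_ge0 => /(_ x1 y1).
  have -> : p * (1 - x) + (1 - p) * (1 - y) = 1 - (p * x + (1 - p) * y) by ring.
  by move=> ?; lra.
Qed.

Lemma lorenz1_max (R : realType) (delta x : R) : delta < 1 ->
  lorenz1 delta x = Num.max 0 ((x - delta) / (1 - delta)).
Proof.
move=> d1; have e0 : 0 < (1 - delta)^-1 by rewrite invr_gt0 subr_gt0.
rewrite /lorenz1; case: leP => xd.
  by rewrite max_l// pmulr_lle0// subr_le0.
by rewrite max_r// mulr_ge0 ?subr_ge0// ltW.
Qed.

Lemma genuine_lorenz1 (R : realType) (delta : R) :
  0 <= delta -> delta < 1 -> genuine_lorenz (lorenz1 delta).
Proof.
move=> d0 d1; have e0 : 0 < 1 - delta by rewrite subr_gt0.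
apply/genuine_lorenzP; split.
- by rewrite /lorenz1 d0.
- by rewrite lorenz1E ?ltW// mulfV// gt_eqF.
- move=> x y _ xy _; rewrite !lorenz1_max// ge_max !le_max lexx/=.
  by rewrite ler_pM2r ?invr_gt0// lerB// orbT.
- move=> p x y /andP[p0 p1] _ _; have q0 : 0 <= 1 - p by rewrite subr_ge0.
  have L0 z : 0 <= lorenz1 delta z by rewrite lorenz1_max// le_max lexx.
  have Lz z : (z - delta) / (1 - delta) <= lorenz1 delta z.
    by rewrite lorenz1_max// le_max lexx orbT.
  rewrite lorenz1_max// ge_max addr_ge0 ?mulr_ge0//=.
  rewrite [leLHS](_ : _ = p * ((x - delta) / (1 - delta))
    + (1 - p) * ((y - delta) / (1 - delta))); last by ring.
  by rewrite lerD// ler_wpM2l.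
Qed.

Theorem mainTheorem3 (R : realType) (delta alpha1 alpha2 pi1 pi2 : R)
  (hdelta0 : 0 <= delta) (hdelta1 : delta < 1)
  (halpha1 : 1 <= alpha1)
  (halpha2_gt0 : 0 < alpha2) (halpha2_le1 : alpha2 <= 1)
  (hpi1 : 0 < pi1) (hpi2 : 0 < pi2) (hpi : pi1 + pi2 < 1) :
  [/\ genuine_lorenz (lorenz1 delta),
      genuine_lorenz (lorenz2 delta alpha1),
      genuine_lorenz (lorenz3 delta alpha2) &
      genuine_lorenz (lorenz4 delta alpha1 alpha2 pi1 pi2)].
Proof.
have H1 := genuine_lorenz1 _ _ hdelta0 hdelta1.
have H2 : genuine_lorenz (lorenz2 delta alpha1).
  have -> : lorenz2 delta alpha1 = (fun u => u `^ alpha1) \o lorenz1 delta.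
    apply/funext => x; rewrite /lorenz2 /lorenz1/=; case: ifP => // _.
    by rewrite powR0// gt_eqF// (lt_le_trans ltr01).
  exact: genuine_lorenz_comp (genuine_lorenz_powR _ _ halpha1) H1.
have H3 : genuine_lorenz (lorenz3 delta alpha2).
  have -> : lorenz3 delta alpha2 =
      (fun u => 1 - (1 - u) `^ alpha2) \o lorenz1 delta.
    apply/funext => x; rewrite /lorenz3 /lorenz1/=; case: ifP => // _.
    by rewrite subr0 powR1 subrr.
  apply: genuine_lorenz_comp H1.
  exact: genuine_lorenz_powR_dual.
split=> //; apply: genuine_lorenz_conv => //; lra.
Qed.
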